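(* Let $R$ be a right non-singular ring. If $0\to A_R\to B_R \to C_R \to 0$ is a short $e$-exact sequence of right $R$-modules, then the induced sequence $0\to A_{\mathfrak{G}} \to B_{\mathfrak{G}} \to C_{\mathfrak{G}}\to 0$ is exact.
   Context: Rings are associative with identity $1\neq 0$, not necessarily commutative; modules are unitary right modules. A submodule $N\le M$ is essential in $M$ if $N\cap X\neq 0$ for every nonzero submodule $X$ of $M$. A short $e$-exact sequence is a cochain complex $0\to A\xrightarrow{f}B\xrightarrow{g}C\to 0$ of right $R$-modules (so $gf=0$) such that $f$ is a monomorphism, $f(A)$ is an essential submodule of $\ker(g)$, and $g(B)$ is an essential submodule of $C$. For a right $R$-module $M$, the singular submodule is $Z(M)=\{x\in M \mid xI=0 \text{ for some essential right ideal } I \text{ of } R\}$; $M$ is singular if $Z(M)=M$ and non-singular if $Z(M)=0$. The ring $R$ is right non-singular if $Z(R_R)=0$. For a right non-singular ring $R$ and a right $R$-module $A$, $A_{\mathfrak{G}}$ denotes a fixed injective envelope $E(A/Z(A))$ of $A/Z(A)$; it is a non-singular module. For a morphism $f\colon A\to B$ of right $R$-modules, the induced morphism $\bar f\colon A/Z(A)\to B/Z(B)$ extends uniquely to a morphism $f_{\mathfrak{G}}\colon A_{\mathfrak{G}}\to B_{\mathfrak{G}}$. Then $R_{\mathfrak{G}}$ is a ring containing $R$, and $(-)_{\mathfrak{G}}\colon \mathrm{Mod}\text{-}R\to\mathrm{Mod}\text{-}R_{\mathfrak{G}}$ is a functor, known to be exact. *)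

(* Defs.v *)
From HB Require Import structures.
From mathcomp Require Import all_boot all_algebra.
From mathcomp Require Import boolp.
Set Implicit Arguments.
Unset Strict Implicit.
Unset Printing Implicit Defensive.
Import GRing.Theory.
Local Open Scope ring_scope.
Local Open Scope quotient_scope.

(* A right R-module is a left module over the converse ring: for x : M with
   M : rmodType R and r : R, the product x r is written r *: x. *)
Notation rmodType R := (lmodType R^c).

(* The module R_R.  Here r *: s is s * r computed in R, so submodules of regmod R
   are the right ideals of R. *)
Notation regmod R := (R^c^o).

Section QuotientModule.
Variables (R : nzRingType) (M : lmodType R) (N : submodClosed M).

Definition zmod_of_submod : zmodClosed M :=
  HB.pack (GRing.SubmodClosed.sort N)
    (GRing.isZmodClosed.Build M _ (GRing.submod_closedB (submodClosedP N))).

Definition quotmod : Type := Quotient.quot zmod_of_submod.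

HB.instance Definition _ := GRing.Zmodule.on quotmod.
HB.instance Definition _ := EqQuotient.on quotmod.

Lemma quotmod_pi_eq (x y : M) : (\pi_quotmod x = \pi_quotmod y) <-> x - y \in N.
Proof.
rewrite (Quotient.idealrBE zmod_of_submod x y).
by split=> [h|/eqP//]; apply/eqP.
Qed.

Lemma quotmod_piD (x y : M) :
  \pi_quotmod (x + y) = \pi_quotmod x + \pi_quotmod y.
Proof. exact: (@Quotient.pi_add M zmod_of_submod). Qed.

Definition quotmod_scale (a : R) (u : quotmod) : quotmod :=
  \pi_quotmod (a *: repr u).

Lemma quotmod_piZ a (x : M) :
  \pi_quotmod (a *: x) = quotmod_scale a (\pi_quotmod x).
Proof.
apply/quotmod_pi_eq; rewrite -scalerBr; apply: rpredZ.
by apply/quotmod_pi_eq; rewrite reprK.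
Qed.

Fact quotmod_scaleA a b u :
  quotmod_scale a (quotmod_scale b u) = quotmod_scale (a * b) u.
Proof.
by rewrite -[u]reprK -(quotmod_piZ b) -!quotmod_piZ scalerA.
Qed.

Fact quotmod_scale1 : left_id 1 quotmod_scale.
Proof. by move=> u; rewrite -[u]reprK -quotmod_piZ scale1r. Qed.

Fact quotmod_scaleDr : right_distributive quotmod_scale +%R.
Proof.
move=> a u v; rewrite -[u]reprK -[v]reprK -quotmod_piD -!quotmod_piZ.
by rewrite scalerDr quotmod_piD.
Qed.

Fact quotmod_scaleDl u : {morph quotmod_scale^~ u : a b / a + b}.
Proof.
by move=> a b; rewrite -[u]reprK -!quotmod_piZ scalerDl quotmod_piD.
Qed.

HB.instance Definition _ := GRing.Zmodule_isLmodule.Build R quotmod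
  quotmod_scaleA quotmod_scale1 quotmod_scaleDr quotmod_scaleDl.

End QuotientModule.

(* K is meant to be a submodule of M; N is an essential submodule of K. *)
Definition essential (R : nzRingType) (M : rmodType R) (N K : {pred M}) : Prop :=
  [/\ submod_closed N, {subset N <= K} &
      forall X : {pred M}, submod_closed X -> {subset X <= K} ->
        (exists2 x, x \in X & x != 0) ->
        exists x, [/\ x \in N, x \in X & x != 0]].

Definition singular (R : nzRingType) (M : rmodType R) : {pred M} := fun x : M =>
  `[< exists2 I : {pred regmod R},
        essential I predT & forall r, r \in I -> (r : R^c) *: x = 0 >].

Arguments singular {R} M.

Definition nonsingular (R : nzRingType) (M : rmodType R) : Prop :=
  forall x : M, x \in singular M -> x = 0.

Definition right_nonsingular (R : nzRingType) : Prop :=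
  nonsingular (regmod R).

Section SingularSubmodule.
Variable R : nzRingType.

Lemma essential_predT (M : rmodType R) : essential (predT : {pred M}) predT.
Proof. by split=> // X _ _ [x Xx x0]; exists x. Qed.

Lemma essential_predI (M : rmodType R) (I J : {pred M}) :
  essential I predT -> essential J predT ->
  essential [predI I & J] predT.
Proof.
move=> [mI _ eI] [mJ _ eJ].
have clI (X Y : {pred M}) : submod_closed X -> submod_closed Y ->
    submod_closed [predI X & Y].
  move=> [X0 Xl] [Y0 Yl]; split; first by rewrite inE X0.
  move=> a u v; rewrite !inE => /andP[Xu Yu] /andP[Xv Yv].
  by rewrite Xl ?Yl.
split=> //; first exact: clI.
move=> X mX _ nX; have [x [Ix Xx x0]] := eI X mX (fun _ _ => isT) nX.
have [|y [Jy /andP[Iy Xy] y0]] :=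
  eJ [predI I & X] (clI _ _ mI mX) (fun _ _ => isT).
  by exists x; rewrite // inE Ix.
by exists y; rewrite inE Iy Jy.
Qed.

(* For an essential right ideal I and a in R, the right ideal
   {s | a s \in I} is essential. *)
Lemma essential_colon (I : {pred regmod R}) (a : R) :
  essential I predT ->
  essential ([pred s : regmod R | (a * s : R) \in I] : {pred regmod R}) predT.
Proof.
move=> [mI _ eI].
pose l (s : regmod R) : regmod R := (a * s : R).
have l0 : l 0 = 0 by rewrite /l (@mulr0 R).
have lP (r : R^c) (u v : regmod R) : l (r *: u + v) = r *: l u + l v.
  rewrite /l; change (r *: u) with ((u : R) * (r : R)).
  by rewrite (@mulrDr R) (@mulrA R).
have mpre : submod_closed ([pred s : regmod R | l s \in I]).
  case: mI => I0 Il; split; first by rewrite inE l0.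
  by move=> r u v; rewrite !inE => Iu Iv; rewrite lP Il.
split=> // X mX _ [x Xx x0].
pose Y : {pred regmod R} := fun y => `[< exists2 s, s \in X & l s = y >].
have mY : submod_closed Y.
  case: (mX) => X0 Xl; split; first by apply/asboolP; exists 0.
  move=> r u v /asboolP[s Xs <-] /asboolP[t Xt <-]; apply/asboolP.
  by exists (r *: s + t); rewrite ?Xl ?lP.
have [lx0|lx0] := eqVneq (l x) 0.
  by exists x; rewrite inE -/(l x) lx0; case: mI.
have [||y [Iy /asboolP[s Xs ls] y0]] := eI Y mY.
- by [].
- by exists (l x) => //; apply/asboolP; exists x.
exists s; split; rewrite ?inE -/(l s) ?ls //.
by apply: contraNneq y0 => s0; rewrite -ls s0 l0.
Qed.

Lemma singular_submod_closed (M : rmodType R) : submod_closed (singular M).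
Proof.
split.
  apply/asboolP; exists (predT : {pred regmod R}); first exact: essential_predT.
  by move=> r _; rewrite scaler0.
move=> a u v /asboolP[I eI Iu] /asboolP[J eJ Jv]; apply/asboolP.
exists ([predI [pred s : regmod R | ((a : R) * s : R) \in I] & J] :
  {pred regmod R}).
  exact: essential_predI (essential_colon _ eI) eJ.
move=> r /andP[/= Ir Jr]; rewrite scalerDr (Jv _ Jr) addr0 scalerA.
exact: Iu Ir.
Qed.

HB.instance Definition _ (M : rmodType R) :=
  GRing.isSubmodClosed.Build R^c M (singular M) (@singular_submod_closed M).

Definition mod_singular (M : rmodType R) : rmodType R := quotmod (singular M).

Section Bar.
Variables (A B : rmodType R) (f : {linear A -> B}).

Definition bar (u : mod_singular A) : mod_singular B :=
  \pi_(quotmod (singular B)) (f (repr u)).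

Lemma bar_pi (x : A) :
  bar (\pi_(quotmod (singular A)) x) = \pi_(quotmod (singular B)) (f x).
Proof.
apply/quotmod_pi_eq; rewrite -linearB.
have : repr (\pi_(quotmod (singular A)) x) - x \in singular A.
  by apply/quotmod_pi_eq; rewrite reprK.
move=> /asboolP[I eI Ix]; apply/asboolP; exists I => // r Ir.
by rewrite -linearZ /= Ix // linear0.
Qed.

Fact bar_is_linear : linear bar.
Proof.
move=> a u v; rewrite -[u]reprK -[v]reprK.
have piZ (C : rmodType R) (c : R^c) (x : C) :
    c *: (\pi_(quotmod (singular C)) x : mod_singular C) =
    \pi_(quotmod (singular C)) (c *: x) by rewrite quotmod_piZ.
by rewrite !bar_pi !piZ -!quotmod_piD bar_pi linearP.
Qed.

HB.instance Definition _ := GRing.isLinear.Build R^c (mod_singular A)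
  (mod_singular B) *:%R bar bar_is_linear.

End Bar.

Definition ker_lin (A B : rmodType R) (f : {linear A -> B}) : {pred A} :=
  [pred x | f x == 0].

Definition im_lin (A B : rmodType R) (f : {linear A -> B}) : {pred B} :=
  fun y => `[< exists x, f x = y >].

Definition short_e_exact (A B C : rmodType R)
    (f : {linear A -> B}) (g : {linear B -> C}) : Prop :=
  [/\ forall x, g (f x) = 0,
      injective f,
      essential (im_lin f) (ker_lin g) &
      essential (im_lin g) predT].

Definition short_exact (A B C : rmodType R)
    (f : {linear A -> B}) (g : {linear B -> C}) : Prop :=
  [/\ injective f, im_lin f =i ker_lin g & im_lin g =i predT].

Definition injective_module (E : rmodType R) : Prop :=
  forall (X Y : rmodType R) (i : {linear X -> Y}) (h : {linear X -> E}),
    injective i -> exists h' : {linear Y -> E}, forall x, h' (i x) = h x.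

Record injective_envelope (M : rmodType R) := InjectiveEnvelope {
  env :> rmodType R;
  env_map : {linear M -> env};
  env_injective : injective_module env;
  env_mono : injective env_map;
  env_essential : essential (im_lin env_map) predT
}.

(* fG : A_G -> B_G extends the morphism bar f : A/Z(A) -> B/Z(B), where EA and
   EB are the chosen envelopes A_G = E(A/Z(A)) and B_G = E(B/Z(B)).  Over a
   right non-singular ring there is exactly one such fG. *)
Definition induced (A B : rmodType R) (f : {linear A -> B})
    (EA : injective_envelope (mod_singular A))
    (EB : injective_envelope (mod_singular B)) (fG : {linear EA -> EB}) : Prop :=
  forall u : mod_singular A, fG (env_map EA u) = env_map EB (bar f u).

Lemma induced_exists (A B : rmodType R) (f : {linear A -> B})
    (EA : injective_envelope (mod_singular A))
    (EB : injective_envelope (mod_singular B)) :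
  exists fG : {linear EA -> EB}, induced f fG.
Proof.
exact: (env_injective (env_map EB \o bar f) (@env_mono _ EA)).
Qed.

End SingularSubmodule.

(* Main.v *)
(** Write [alpha : A -> A_G] for the composite [envelope_of] of [A -> A/Z(A)] with
    the envelope map, and similarly [beta], [gamma].  Over a right non-singular ring these
    envelopes are non-singular, so a nonzero element of one of them is never
    killed by an essential right ideal; this lets us push elements of [ker g] and
    [C] into the essential submodules [f(A)] and [g(B)] without killing them.
    Thus [f_G] is injective, hence has a retraction [h] since [A_G] is injective;
    [ker g_G] meets [ker h] in zero, which gives [ker g_G = im f_G] and makes
    [(g_G, h) : B_G -> C_G * A_G] a monomorphism.  As [B_G] is injective, this
    monomorphism has a retraction, from which [im g_G] is seen to be a direct
    summand of [C_G]; being essential, it is everything. *)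
From HB Require Import structures.
Require Import Defs.
From mathcomp Require Import all_boot all_algebra.
From mathcomp Require Import boolp.
Set Implicit Arguments.
Unset Strict Implicit.
Unset Printing Implicit Defensive.
Import GRing.Theory.
Local Open Scope ring_scope.
Local Open Scope quotient_scope.

Local Notation quot_singular R M := (@quotmod R^c M (singular M)).

(** * Essential submodules and singular submodules *)

Section Essential.
Context {R : nzRingType}.
Implicit Types M N : rmodType R.

Lemma ker_lin_closed M N (f : {linear M -> N}) : submod_closed (ker_lin f).
Proof.
split=> [|a u v]; rewrite !inE ?linear0 // => /eqP fu /eqP fv.
by rewrite linearP fu fv scaler0 addr0.
Qed.

Lemma predT_closed M : submod_closed (predT : {pred M}).
Proof. by []. Qed.

Lemma submod_closedI M (X Y : {pred M}) :
  submod_closed X -> submod_closed Y -> submod_closed [predI X & Y].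
Proof.
move=> [X0 Xl] [Y0 Yl]; split=> [|a u v]; first by rewrite inE X0.
by rewrite !inE => /andP[Xu Yu] /andP[Xv Yv]; rewrite Xl ?Yl.
Qed.

(** Either [f] kills a nonzero element of [X], which then lies in the preimage of [I], or [f(X)] is
    a nonzero submodule of [K] and meets [I]. *)
Lemma essential_preim M N (f : {linear M -> N}) (I K : {pred N}) :
  essential I K ->
  essential ([pred x | f x \in I] : {pred M}) [pred x | f x \in K].
Proof.
move=> [[I0 Il] IK eI]; split=> [|x|X [X0 Xl] XK [x Xx x0]].
- by split=> [|a u v]; rewrite !inE ?linear0 // linearP; apply: Il.
- by rewrite !inE; apply: IK.
have [fx0|fx0] := eqVneq (f x) 0; first by exists x; rewrite inE fx0.
pose Y : {pred N} := fun y => `[< exists2 u, u \in X & f u = y >].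
have mY : submod_closed Y.
  split=> [|a _ _ /asboolP[u Xu <-] /asboolP[v Xv <-]]; apply/asboolP.
    by exists 0; rewrite ?linear0.
  by exists (a *: u + v); rewrite ?linearP ?Xl.
have YK : {subset Y <= K} by move=> _ /asboolP[u /XK Ku <-].
have [|y [Iy /asboolP[u Xu fu] y0]] := eI Y mY YK.
  by exists (f x) => //; apply/asboolP; exists x.
exists u; rewrite inE fu; split=> //.
by apply: contraNneq y0 => u0; rewrite -fu u0 linear0.
Qed.

Section Orbit.
Variables (M : rmodType R) (x : M).

Definition orbit_map (r : regmod R) : M := (r : R^c) *: x.

Fact orbit_map_is_linear : linear orbit_map.
Proof. by move=> a u v; rewrite /orbit_map scalerDl scalerA. Qed.

HB.instance Definition _ := GRing.isLinear.Build R^c (regmod R) M *:%R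
  orbit_map orbit_map_is_linear.

End Orbit.

(** Preimage of [N] under [orbit_map x], which sends all of [R] into [K]. *)
Lemma essential_conductor M (N K : {pred M}) (x : M) :
  submod_closed K -> essential N K -> x \in K ->
  essential ([pred r : regmod R | (r : R^c) *: x \in N] : {pred regmod R}) predT.
Proof.
move=> [K0 Kl] /(essential_preim (orbit_map x))[mI _ eI] Kx.
split=> // X mX _ nX; apply: eI => // r _.
by rewrite inE /= /orbit_map -[_ *: x]addr0 Kl.
Qed.

Lemma nonsingular_scale_neq0 M (I : {pred regmod R}) (x : M) :
  nonsingular M -> essential I predT -> x != 0 ->
  exists2 r, r \in I & (r : R^c) *: x != 0.
Proof.
move=> nM eI /eqP x0; apply: contrapT => nI; apply/x0/nM/asboolP.
exists I => // r Ir; apply/eqP/negPn/negP => rx0.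
by apply: nI; exists r.
Qed.

Lemma nonsingular_essential M N (i : {linear M -> N}) :
  injective i -> essential (im_lin i) predT -> nonsingular M -> nonsingular N.
Proof.
move=> inj_i [_ _ ei] nM y Zy; apply/eqP/negPn/negP => y0.
have [|z [/asboolP[x <-] /asboolP[I eI Ix] /eqP]] :=
    ei _ (singular_submod_closed N) (fun _ _ => isT); first by exists y.
apply; rewrite (nM x) ?linear0 //; apply/asboolP; exists I => // r Ir.
by apply: inj_i; rewrite linearZ linear0; apply: Ix.
Qed.

(** The annihilator of [x] is essential: for nonzero [r] in [I] and [X], an essential [J] kills
    [r *: x], and non-singularity of [R] gives [s] in [J] with [s *: r] nonzero. This yields
    [Z(M/Z(M)) = 0]. *)
Lemma singular_essential_scale M (x : M) (I : {pred regmod R}) :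
  right_nonsingular R -> essential I predT ->
  (forall r, r \in I -> (r : R^c) *: x \in singular M) -> x \in singular M.
Proof.
move=> hR [_ _ eI] ZI; apply/asboolP; exists (ker_lin (orbit_map x)); last first.
  by move=> r; rewrite inE => /eqP.
split=> [||X mX _ nX]; [exact: ker_lin_closed | by [] |].
have [r [Ir Xr r0]] := eI X mX (fun _ _ => isT) nX.
have /asboolP[J eJ Jrx] := ZI r Ir.
have [s Js sr0] := nonsingular_scale_neq0 hR eJ r0.
exists ((s : R^c) *: r); split=> //.
  by rewrite inE linearZ; apply/eqP/Jrx.
by case: mX => X0 Xl; rewrite -[_ *: _]addr0 Xl.
Qed.

Lemma pi_singular_eq0 M (x : M) :
  \pi_(quot_singular R M) x = 0 <-> x \in singular M.
Proof.
have <- : \pi_(quot_singular R M) 0 = 0.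
  by rewrite -[X in \pi X](scale0r (0 : M)) quotmod_piZ; apply: scale0r.
by split=> [/quotmod_pi_eq|Zx]; [|apply/quotmod_pi_eq]; rewrite subr0.
Qed.

Lemma nonsingular_mod_singular M :
  right_nonsingular R -> nonsingular (mod_singular M).
Proof.
move=> hR u; rewrite -[u]reprK => /asboolP[I eI Iu].
apply/pi_singular_eq0; apply: singular_essential_scale hR eI _ => r Ir.
by apply/pi_singular_eq0; rewrite quotmod_piZ; apply: Iu.
Qed.

End Essential.

(** * Injective envelopes of [M/Z(M)] *)

Section Envelope.
Context {R : nzRingType} {M : rmodType R}.
Variable E : injective_envelope (mod_singular M).

Definition envelope_of (x : M) : E := env_map E (\pi_(quot_singular R M) x).

Fact envelope_of_is_linear : linear envelope_of.
Proof.
by move=> a u v; rewrite /envelope_of quotmod_piD quotmod_piZ -linearP.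
Qed.

HB.instance Definition _ := GRing.isLinear.Build R^c M E *:%R
  envelope_of envelope_of_is_linear.

Lemma envelope_of_eq0 (x : M) : envelope_of x = 0 <-> x \in singular M.
Proof.
rewrite -pi_singular_eq0; split=> [|x0]; last by rewrite /envelope_of x0 linear0.
by rewrite -(linear0 (env_map E)) => /env_mono.
Qed.

Lemma envelope_nonsingular : right_nonsingular R -> nonsingular E.
Proof.
move/nonsingular_mod_singular => /(_ M).
exact: nonsingular_essential (@env_mono _ _ E) (env_essential E).
Qed.

(** Reduces questions about submodules of the envelope to elements of [M] itself, where the
    hypotheses on [f] and [g] apply. *)
Lemma envelope_of_meets (X : {pred E}) : submod_closed X ->
  (exists2 y, y \in X & y != 0) ->
  exists2 x, envelope_of x \in X & envelope_of x != 0.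
Proof.
move=> mX nX; have [_ _ eE] := env_essential E.
have [y [/asboolP[u uy]]] := eE X mX (fun _ _ => isT) nX.
by rewrite -uy -[u]reprK; exists (repr u).
Qed.

End Envelope.

Lemma induced_envelope_of (R : nzRingType) (A B : rmodType R) (f : {linear A -> B})
    (AG : injective_envelope (mod_singular A))
    (BG : injective_envelope (mod_singular B)) (fG : {linear AG -> BG}) :
  induced f fG -> forall x, fG (envelope_of AG x) = envelope_of BG (f x).
Proof. by move=> ifG x; rewrite /envelope_of ifG bar_pi. Qed.

(** * The induced maps *)

Section InducedExact.
Context {R : nzRingType} {A B C : rmodType R}.
Variables (f : {linear A -> B}) (g : {linear B -> C}).
Variables (AG : injective_envelope (mod_singular A))
          (BG : injective_envelope (mod_singular B))
          (CG : injective_envelope (mod_singular C))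
          (fG : {linear AG -> BG}) (gG : {linear BG -> CG}).
Hypotheses (hR : right_nonsingular R) (ifG : induced f fG) (igG : induced g gG).

Lemma induced_injective : injective f -> injective fG.
Proof.
move=> inj_f u v /eqP; rewrite -subr_eq0 -linearB => fGuv.
apply/eqP; rewrite -subr_eq0; apply/negPn/negP => uv0.
have [|x] := envelope_of_meets (ker_lin_closed fG).
  by exists (u - v).
rewrite inE (induced_envelope_of ifG) => /eqP/envelope_of_eq0/asboolP[I eI Ifx].
move/eqP; apply; apply/envelope_of_eq0/asboolP; exists I => // r Ir.
by apply: inj_f; rewrite linearZ linear0; apply: Ifx.
Qed.

(** The composite vanishes on [A/Z(A)], and an essential right ideal multiplies [y] into it; a
    nonzero value in [C_G] would survive some such multiplication. *)
Lemma induced_comp0 : (forall x, g (f x) = 0) -> forall y, gG (fG y) = 0.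
Proof.
move=> gf0 y; apply/eqP/negPn/negP => y0.
have eI := essential_conductor (predT_closed AG) (env_essential AG)
  (isT : y \in predT).
have [r /asboolP[u uy]] :=
  nonsingular_scale_neq0 (envelope_nonsingular (E := CG) hR) eI y0.
rewrite -!linearZ /= -uy -[u]reprK -/(envelope_of _ _).
by rewrite (induced_envelope_of ifG) (induced_envelope_of igG) gf0 linear0 eqxx.
Qed.

(* A nonzero element of [X] may be taken of the form [beta b]; multiplying [b]
   into [ker g], and then into [f(A)], keeps [beta b] nonzero. *)
Lemma ker_induced_meets (X : {pred BG}) :
  essential (im_lin f) (ker_lin g) -> submod_closed X ->
  {subset X <= ker_lin gG} -> (exists2 y, y \in X & y != 0) ->
  exists x, [/\ fG x \in X & fG x != 0].
Proof.
move=> ef mX XK /(envelope_of_meets mX)[b Xb b0]; have [X0 Xl] := mX.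
have XZ r y : y \in X -> r *: y \in X by move=> Xy; rewrite -[_ *: y]addr0 Xl.
have nB := envelope_nonsingular (E := BG) hR.
have /asboolP[I eI Igb] : g b \in singular C.
  apply/(envelope_of_eq0 CG); rewrite -(induced_envelope_of igG).
  by apply/eqP/XK.
have [r /Igb rgb rb0] := nonsingular_scale_neq0 nB eI b0.
have Krb : (r : R^c) *: b \in ker_lin g by rewrite inE linearZ /= rgb.
have eJ := essential_conductor (ker_lin_closed g) ef Krb.
have [s /asboolP[x fx] sb0] := nonsingular_scale_neq0 nB eJ rb0.
exists (envelope_of AG x); rewrite (induced_envelope_of ifG) fx !linearZ /=.
by split=> //; apply/XZ/XZ.
Qed.

Lemma im_induced_meets (X : {pred CG}) :
  essential (im_lin g) predT -> submod_closed X ->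
  (exists2 y, y \in X & y != 0) ->
  exists y, [/\ gG y \in X & gG y != 0].
Proof.
move=> eg mX /(envelope_of_meets mX)[c Xc c0]; have [X0 Xl] := mX.
have eI := essential_conductor (predT_closed C) eg (isT : c \in predT).
have nC := envelope_nonsingular (E := CG) hR.
have [r /asboolP[b gb] rc0] := nonsingular_scale_neq0 nC eI c0.
exists (envelope_of BG b); rewrite (induced_envelope_of igG) gb linearZ /=.
by split=> //; rewrite -[_ *: _]addr0 Xl.
Qed.

End InducedExact.

Theorem corollary3p5 (R : nzRingType) (hR : right_nonsingular R)
  (A B C : rmodType R) (f : {linear A -> B}) (g : {linear B -> C})
  (AG : injective_envelope (mod_singular A))
  (BG : injective_envelope (mod_singular B))
  (CG : injective_envelope (mod_singular C))
  (fG : {linear AG -> BG}) (gG : {linear BG -> CG}) :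
  short_e_exact f g ->
  induced f fG -> induced g gG ->
  short_exact fG gG.
Proof.
move=> [gf0 inj_f ef eg] ifG igG.
have inj_fG := induced_injective ifG inj_f.
have gfG0 := induced_comp0 hR ifG igG gf0.
have [h hf] := @env_injective _ _ AG _ _ _ idfun inj_fG.
(* Otherwise the two kernels share some nonzero [fG x], yet [x = h (fG x) = 0]. *)
have ker_gh y : gG y = 0 -> h y = 0 -> y = 0.
  move=> gy hy; apply/eqP/negPn/negP => y0.
  have mX := submod_closedI (ker_lin_closed gG) (ker_lin_closed h).
  have XK : {subset [predI ker_lin gG & ker_lin h] <= ker_lin gG}.
    by move=> z /andP[].
  have [|x [/andP[_]]] := ker_induced_meets hR ifG igG ef mX XK.
    by exists y => //; rewrite !inE gy hy !eqxx.
  by rewrite inE hf => /eqP/= ->; rewrite linear0 eqxx.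
pose gh (y : BG) : (CG * AG)%type := (gG y, h y).
have gh_linear : linear gh by move=> a u v; rewrite /gh !linearP.
pose ghL : {linear BG -> (CG * AG)%type} :=
  HB.pack gh (GRing.isLinear.Build R^c BG (CG * AG)%type *:%R gh gh_linear).
have inj_gh : injective ghL.
  move=> u v [guv huv]; apply/eqP; rewrite -subr_eq0; apply/eqP/ker_gh.
    by rewrite linearB guv subrr.
  by rewrite linearB huv subrr.
have [k kgh] := @env_injective _ _ BG _ _ _ idfun inj_gh.
(* [s] will be the projection of [C_G] onto [im gG]. *)
pose s (c : CG) : CG := gG (k (c, 0)).
have sg y : s (gG y) = gG y.
  (* The correction moves [y] into [ker h], so that [(gG y, 0)] becomes a value of [gh], where [k]
     inverts it. *)
  have -> : gG y = gG (y - fG (h y)) by rewrite linearB gfG0 subr0.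
  rewrite /s; congr (gG _).
  have -> : (gG (y - fG (h y)), 0) = ghL (y - fG (h y)).
    by rewrite /= /gh (linearB h) /= hf subrr.
  by rewrite kgh.
have s_linear : linear s.
  move=> a u v; rewrite /s -!linearP; congr (gG (k _)).
  by rewrite /= -[RHS]/(_, _) /= scaler0 addr0.
pose sL : {linear CG -> CG} :=
  HB.pack s (GRing.isLinear.Build R^c CG CG *:%R s s_linear).
(* A nonzero [ker s] would meet [im gG], which [s] fixes pointwise. *)
have ker_s c : s c = 0 -> c = 0.
  move=> sc; apply/eqP/negPn/negP => c0.
  have [|y []] := im_induced_meets hR igG eg (ker_lin_closed sL).
    by exists c; rewrite // inE /= sc.
  by rewrite inE /= sg => ->.
split=> // y.
  apply/asboolP/eqP => [[x <-]|gy]; first exact: gfG0.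
  exists (h y); apply/esym/eqP; rewrite -subr_eq0; apply/eqP/ker_gh.
    by rewrite linearB gfG0 gy subrr.
  by rewrite linearB /= hf subrr.
(* This witness has image [s y], and [y - s y] lies in [ker s] since [s] is idempotent. *)
apply/asboolP; exists (k (y, 0)); apply/esym/eqP; rewrite -subr_eq0.
apply/eqP/ker_s; rewrite -[s _]/(sL _) linearB /=.
by rewrite -[X in _ - s X]/(s y) sg subrr.
Qed.
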